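(* For every MAL formula $A$, every closed term $t$ and every $n\in\mathbb N$, $$(t,n)\Vdash_{Time}A\iff t\Vdash^\bullet(\mathbf n\Vdash_fA),$$ where $\Vdash_{Time}$ is the quantitative realizability (over the monoid $\mathbb N$) with pole $\Bbbk_{Time}=\{(c,n):c\text{ normalizes for }\to_0\text{ using at most }n\ \beta\text{-steps}\}$ and valuation $\rho(X)=\{(\maltese_+,p):p\in\mathbb N\}$, and $\Vdash^\bullet$ is the countdown-machine realizability with pole $\Bbbk^\bullet=\{c\text{ forcing command}:c\text{ normalizes for }\to_\bullet\}$ and valuation $\rho^\bullet(X^{\iota\to o^+})(p)=\{\maltese_+\}$ for all $p\in\mathbb N$.
   Context: **Terms.** Positive variables $x,\dots$, negative variables $\alpha,\dots$, $\kappa,\kappa'$ of either polarity. Positive values $V_+::=x\mid (V,V')\mid\{V\}\mid\overline n\ (n\in\mathbb N)\mid\maltese_+$; values $V::=V_+\mid t_-$; positive terms $t_+::=V_+\mid\mu\alpha.c$; negative terms $t_-::=\alpha\mid\mu(\kappa,\kappa').c\ (\kappa\neq\kappa')\mid\mu\{\kappa\}.c\mid\mu x.c\mid\maltese_-$; commands $c::=\langle t_+|t_-\rangle$ with $\langle t|u\rangle$ and $\langle u|t\rangle$ identified. $\overline n,\maltese_+,\maltese_-$ are constants without reduction rules of their own. Pairs/one-tuples $(t,u)$, $\{t\}$ of non-values, should they occur, are abbreviations for $\mu\alpha.\langle t|\mu\kappa.\langle u|\mu\kappa'.\langle(\kappa,\kappa')|\alpha\rangle\rangle\rangle$, $\mu\alpha.\langle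 t|\mu\kappa.\langle\{\kappa\}|\alpha\rangle\rangle$. **Reduction** $\to_0=\to_\mu\cup\to_\beta$ on commands: $\langle\mu\alpha.c|t_-\rangle\to_\mu c[t_-/\alpha]$; $\langle V_+|\mu x.c\rangle\to_\mu c[V_+/x]$; $\langle\{V\}|\mu\{\kappa\}.c\rangle\to_\beta c[V/\kappa]$; $\langle(V,V')|\mu(\kappa,\kappa').c\rangle\to_\beta c[V/\kappa,V'/\kappa']$ (polarities matching). **Countdown machine.** A negative command is $\langle t^\ominus|u_+\rangle$ with $t$ a term of either polarity and $u_+$ a positive term ($\ominus$ is just a mark). A forcing command is a negative command $\langle t^\ominus|(u,K)\rangle$, also written $\langle t^\ominus|u\rangle\{K\}$, where $K$ is a term and $t,u$ are terms of opposite polarities; $\langle t^\ominus|u\rangle\{K\}$ and $\langle u^\ominus|t\rangle\{K\}$ are identified. For a command $c=\langle t_+|u_-\rangle$, $c^\bullet\{K\}=\langle u_-^\ominus|(t_+,K)\rangle$. Reduction $\to_\bullet$: $\langle t_-^\ominus|\mu\alpha.c\rangle\{\overline n\}\to_\bullet(c[t_-/\alpha])^\bullet\{\overline n\}$; $\langle(\mu x.c)^\ominus|V_+\rangle\{\overline n\}\to_\bullet(c[V_+/x])^\bullet\{\overline n\}$; $\langle(\mu(\kappa,\kappa').c)^\ominus|(V_1,V_2)\rangle\{\overline{n+1}\}\to_\bullet(c[V_1/\kappa,V_2/\kappa'])^\bullet\{\overline n\}$; $\langle(\mu\{\kappa\}.c)^\ominus|\{V\}\rangle\{\overline{n+1}\}\to_\bullet(c[V/\kappa])^\bullet\{\overline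 n\}$; the last two redexes with counter $\overline0$ diverge (hence do not normalize). If $K$ is not some $\overline n$, $c^\bullet\{K\}$ does not reduce. **Countdown interpretation.** Let $\Bbbk^\bullet_0=\{\langle t_+|u_-\rangle:\langle u_-^\ominus|t_+\rangle\in\Bbbk^\bullet\}$. Closed terms $t_+$ (positive) and $u_-$ (negative) are orthogonal if $\langle t_+|u_-\rangle\in\Bbbk^\bullet_0$; for a set $X$ of closed terms of one polarity, $X^\bot$ is the set of closed terms of the other polarity orthogonal to all elements of $X$. $\|\mathcal C[p]\|^\bullet=\{\overline n:n\in\mathbb N,p\le n\}$ interprets a positive predicate constant $\mathcal C[\cdot]$ on natural numbers. A variable $X^{\iota\to o^+}$ (positive predicate on natural numbers) is interpreted by $\rho^\bullet$; $\|A\otimes B\|^\bullet=\{(t,u):t\in\|A\|^\bullet,u\in\|B\|^\bullet\}$; $\|\downarrow A\|^\bullet=\{\{t\}:t\in\|A\|^\bullet\}$; $\|\exists r.A\|^\bullet=\bigcup_{r\in\mathbb N}\|A\|^\bullet$ for $A$ positive. The equational implication $\langle T=U\rangle A$ (informally ''$T\cong U$ implies $A$'', of the same polarity as $A$) is interpreted as $A$ is if $T\cong U$ (i.e. $T$ and $U$ are convertible: they denote the same number), and by $\emptyset^\bot$ (all closed terms of the polarity of $A$) otherwise. A negative formula $N$ (built with $\wp,\uparrow,\forall$) is interpreted by orthogonality: $t\in\|N\|^\bullet$ iff $\langle t^\ominus|u\rangle\in\Bbbk^\bullet$ for every $u\in\|N^\bot\|^\bullet$, where $t$ is a closed term that need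 not be negative. Realizability: $t\Vdash^\bullet A$ means $t\in\|A\|^\bullet$. **MAL and forcing translation.** MAL formulas: $A,B::=P\mid N$; positive $P::=X\mid A\otimes B\mid\downarrow A$; negative $N::=X^\bot\mid A\wp B\mid\uparrow A$, with the usual De Morgan involutive negation ($\otimes/\wp$, $\downarrow/\uparrow$, $X/X^\bot$). For a predicate $Z$ on natural numbers, its forcing orthogonal is $\overline Z=\lambda r.\forall r'.\,Z(r')\multimap\mathcal C[r+r']^\bot$, with $A\multimap B=A^\bot\wp B$; thus $\|\overline Z(\mathbf p)\|^\bullet$ is the set of closed $t$ such that $\langle t^\ominus|(u,K)\rangle\in\Bbbk^\bullet$ for all $r\in\mathbb N$, $u\in\|Z(\mathbf r)\|^\bullet$, $K\in\|\mathcal C[p+r]\|^\bullet$. The translation: $X^*=X^{\iota\to o^+}$; $(X^\bot)^*=\overline{X^{\iota\to o^+}}$; $(A\otimes B)^*=\lambda r.\exists p_1.\exists p_2.\langle r=p_1+p_2\rangle(A^*(p_1)\otimes B^*(p_2))$; $(A\wp B)^*=\overline{\lambda r.\exists p_1.\exists p_2.\langle r=p_1+p_2\rangle((A^\bot)^*(p_1)\otimes(B^\bot)^*(p_2))}$; $(\downarrow A)^*=\lambda r.\downarrow A^*(r)$; $(\uparrow A)^*=\overline{\lambda r.\downarrow(A^\bot)^*(r)}$. Forcing: $p\Vdash_fP\equiv\overline{\overline{P^*}}(p)$ for $P$ positive, $p\Vdash_fN\equiv N^*(p)$ for $N$ negative. $\mathbf n$ is the numeral of $n$. **Quantitative realizability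 $\Vdash_{Time}$.** Here $c$ in $\Bbbk_{Time}$ ranges over closed commands. A closed positive weighted term $(t_+,p)$ and a closed negative weighted term $(t_-,q)$ ($p,q\in\mathbb N$) are orthogonal if $(\langle t_+|t_-\rangle,p+q)\in\Bbbk_{Time}$; for a set $X$ of positive (resp. negative) weighted terms, $X^\bot$ is the set of negative (resp. positive) weighted terms orthogonal to every element of $X$. $\|X\|=\rho(X)$; $\|X^\bot\|=\rho(X)^\bot$; $\|A\otimes B\|=\{((t,u),p+q):(t,p)\in\|A\|,(u,q)\in\|B\|\}$; $\|\downarrow A\|=\{(\{t\},p):(t,p)\in\|A\|\}$; $\|A\wp B\|=\|A^\bot\otimes B^\bot\|^\bot$; $\|\uparrow A\|=\|\downarrow A^\bot\|^\bot$. $(t,n)\Vdash_{Time}A$ means $(t,n)\in\|A\|$.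
   Formalization: For positive P, time-realizers are taken in the biorthogonal of ‖P‖ (with ‖P‖ itself the claim fails at A=X, t=μα.⟨✠₊|α⟩), and a false equational implication on a positive formula is interpreted by ∅ rather than by all closed positive terms. *)

(* Defs.v *)
From Stdlib Require Import List Relations.
Import ListNotations.

Set Implicit Arguments.
Unset Strict Implicit.

Inductive pol : Type := Pos | Neg.

Definition opp (e : pol) : pol := match e with Pos => Neg | Neg => Pos end.

(** Well-scoped de Bruijn syntax: a context lists the polarities of the free
    variables, so that terms are identified up to renaming of bound variables
    and the closed terms are those over [[]]. *)
Definition ctx : Type := list pol.

Inductive var : ctx -> pol -> Type :=
| VZ (G : ctx) (e : pol) : var (e :: G) e
| VS (G : ctx) (e e' : pol) : var G e -> var (e' :: G) e.

Arguments VZ {G e}.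
Arguments VS {G e e'} _.

(** [val G Pos] is the type of positive values and [val G Neg] that of negative
    terms (all of which are values), so [val G e] is the type of values of
    polarity [e].  In [MuPair c], the command [c] binds the second component as
    index 0 and the first one as index 1.  A command <t+|u-> = <u-|t+> is stored
    with its positive side first. *)
Inductive val (G : ctx) : pol -> Type :=
| Var (e : pol) : var G e -> val G e
| Pair (e1 e2 : pol) : val G e1 -> val G e2 -> val G Pos
| Box (e : pol) : val G e -> val G Pos
| Num : nat -> val G Pos
| Daimon (e : pol) : val G e
| MuPair (e1 e2 : pol) : cmd (e2 :: e1 :: G) -> val G Neg
| MuBox (e : pol) : cmd (e :: G) -> val G Neg
| MuPos : cmd (Pos :: G) -> val G Neg
with pterm (G : ctx) : Type :=
| PVal : val G Pos -> pterm G
| MuNeg : cmd (Neg :: G) -> pterm G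
with cmd (G : ctx) : Type :=
| Cut : pterm G -> val G Neg -> cmd G.

Arguments Num {G} _.
Arguments Daimon {G} e.

Inductive term (G : ctx) : Type :=
| TPos : pterm G -> term G
| TNeg : val G Neg -> term G.

Definition tpol (G : ctx) (t : term G) : pol :=
  match t with TPos _ => Pos | TNeg _ => Neg end.

Definition cterm : Type := term [].
Definition ccmd : Type := cmd [].

Definition numeral (G : ctx) (n : nat) : term G := TPos (PVal (Num n)).

Definition ren (G D : ctx) : Type := forall e, var G e -> var D e.

Definition ren_up (G D : ctx) (e0 : pol) (r : ren G D) : ren (e0 :: G) (e0 :: D) :=
  fun e x =>
    match x in var G' e return
      match G' with [] => unit | e1 :: G0 => ren G0 D -> var (e1 :: D) e end with
    | VZ => fun _ => VZ
    | VS y => fun r => VS (r _ y)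
    end r.

Fixpoint ren_val (G D : ctx) (r : ren G D) (e : pol) (v : val G e) {struct v} : val D e :=
  match v with
  | Var x => Var (r _ x)
  | Pair v1 v2 => Pair (ren_val r v1) (ren_val r v2)
  | Box v1 => Box (ren_val r v1)
  | Num n => Num n
  | Daimon e => Daimon e
  | MuPair c => MuPair (ren_cmd (ren_up (ren_up r)) c)
  | MuBox c => MuBox (ren_cmd (ren_up r) c)
  | MuPos c => MuPos (ren_cmd (ren_up r) c)
  end
with ren_pterm (G D : ctx) (r : ren G D) (t : pterm G) {struct t} : pterm D :=
  match t with
  | PVal v => PVal (ren_val r v)
  | MuNeg c => MuNeg (ren_cmd (ren_up r) c)
  end
with ren_cmd (G D : ctx) (r : ren G D) (c : cmd G) {struct c} : cmd D :=
  match c with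
  | Cut t u => Cut (ren_pterm r t) (ren_val r u)
  end.

Definition shift (G : ctx) (e0 : pol) : ren G (e0 :: G) := fun e x => VS x.

Definition wk (G : ctx) (e0 : pol) (t : term G) : term (e0 :: G) :=
  match t with
  | TPos t => TPos (ren_pterm (@shift G e0) t)
  | TNeg u => TNeg (ren_val (@shift G e0) u)
  end.

Definition sub (G D : ctx) : Type := forall e, var G e -> val D e.

Definition sub_id (G : ctx) : sub G G := fun e x => Var x.

Definition sub_cons (G D : ctx) (e0 : pol) (v : val D e0) (s : sub G D) : sub (e0 :: G) D :=
  fun e x =>
    match x in var G' e return
      match G' with [] => unit | e1 :: G0 => val D e1 -> sub G0 D -> val D e end with
    | VZ => fun v _ => v
    | VS y => fun _ s => s _ y
    end v s.

Definition sub_up (G D : ctx) (e0 : pol) (s : sub G D) : sub (e0 :: G) (e0 :: D) :=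
  sub_cons (Var VZ) (fun e x => ren_val (@shift D e0) (s e x)).

Fixpoint sub_val (G D : ctx) (s : sub G D) (e : pol) (v : val G e) {struct v} : val D e :=
  match v in val _ e return val D e with
  | Var x => s _ x
  | Pair v1 v2 => Pair (sub_val s v1) (sub_val s v2)
  | Box v1 => Box (sub_val s v1)
  | Num n => Num n
  | Daimon e => Daimon e
  | MuPair c => MuPair (sub_cmd (sub_up (sub_up s)) c)
  | MuBox c => MuBox (sub_cmd (sub_up s) c)
  | MuPos c => MuPos (sub_cmd (sub_up s) c)
  end
with sub_pterm (G D : ctx) (s : sub G D) (t : pterm G) {struct t} : pterm D :=
  match t with
  | PVal v => PVal (sub_val s v)
  | MuNeg c => MuNeg (sub_cmd (sub_up s) c)
  end
with sub_cmd (G D : ctx) (s : sub G D) (c : cmd G) {struct c} : cmd D :=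
  match c with
  | Cut t u => Cut (sub_pterm s t) (sub_val s u)
  end.

Definition inst1 (G : ctx) (e : pol) (c : cmd (e :: G)) (v : val G e) : cmd G :=
  sub_cmd (sub_cons v (@sub_id G)) c.

Definition inst2 (G : ctx) (e1 e2 : pol) (c : cmd (e2 :: e1 :: G))
    (v1 : val G e1) (v2 : val G e2) : cmd G :=
  sub_cmd (sub_cons v2 (sub_cons v1 (@sub_id G))) c.

Definition value_of (G : ctx) (t : term G) : option (val G (tpol t)) :=
  match t with
  | TPos (PVal v) => Some v
  | TPos (MuNeg _) => None
  | TNeg u => Some u
  end.

(** <t | mu k. c>, where k has the polarity of [t]. *)
Definition cut_mu (G : ctx) (t : term G) : cmd (tpol t :: G) -> cmd G :=
  match t with
  | TPos t => fun c => Cut t (MuPos c)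
  | TNeg u => fun c => Cut (MuNeg c) u
  end.

Arguments cut_mu {G} t _.

(** (t,u), which abbreviates mu a.<t|mu k.<u|mu k'.<(k,k')|a>>> unless both
    components are values. *)
Definition pair (G : ctx) (t u : term G) : pterm G :=
  match value_of t, value_of u with
  | Some v, Some w => PVal (Pair v w)
  | _, _ =>
      MuNeg (cut_mu (wk Neg t)
              (cut_mu (wk _ (wk Neg u))
                (Cut (PVal (Pair (Var (VS VZ)) (Var VZ))) (Var (VS (VS VZ))))))
  end.

(** {t}, which abbreviates mu a.<t|mu k.<{k}|a>> unless [t] is a value. *)
Definition box (G : ctx) (t : term G) : pterm G :=
  match value_of t with
  | Some v => PVal (Box v)
  | None => MuNeg (cut_mu (wk Neg t) (Cut (PVal (Box (Var VZ))) (Var (VS VZ))))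
  end.

Inductive mu_step (G : ctx) : cmd G -> cmd G -> Prop :=
| mu_neg (c : cmd (Neg :: G)) (u : val G Neg) :
    mu_step (Cut (MuNeg c) u) (inst1 c u)
| mu_pos (v : val G Pos) (c : cmd (Pos :: G)) :
    mu_step (Cut (PVal v) (MuPos c)) (inst1 c v).

Inductive beta_step (G : ctx) : cmd G -> cmd G -> Prop :=
| beta_box (e : pol) (v : val G e) (c : cmd (e :: G)) :
    beta_step (Cut (PVal (Box v)) (MuBox c)) (inst1 c v)
| beta_pair (e1 e2 : pol) (v1 : val G e1) (v2 : val G e2) (c : cmd (e2 :: e1 :: G)) :
    beta_step (Cut (PVal (Pair v1 v2)) (MuPair c)) (inst2 c v1 v2).

Definition step0 (G : ctx) (c c' : cmd G) : Prop := mu_step c c' \/ beta_step c c'.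

(** [steps0 k c c']: c reduces to c' by ->0 with exactly k beta-steps. *)
Inductive steps0 (G : ctx) : nat -> cmd G -> cmd G -> Prop :=
| steps0_refl (c : cmd G) : steps0 0 c c
| steps0_mu (k : nat) (c c' c'' : cmd G) :
    mu_step c c' -> steps0 k c' c'' -> steps0 k c c''
| steps0_beta (k : nat) (c c' c'' : cmd G) :
    beta_step c c' -> steps0 k c' c'' -> steps0 (S k) c c''.

Definition k_time (c : ccmd) (n : nat) : Prop :=
  exists (k : nat) (c' : ccmd),
    k <= n /\ steps0 k c c' /\ (forall c'', ~ step0 c' c'').

(** The negative command <t^(-)|u+>. *)
Record ncmd (G : ctx) : Type := NCmd { nc_left : term G; nc_right : pterm G }.

(** c{K}, which represents both <u-^(-)|(t+,K)> and <t+^(-)|(u-,K)> for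
    c = <t+|u->; [is_forcing d f] says that the negative command [d] is the
    forcing command [f]. *)
Record fcmd (G : ctx) : Type := FCmd { fc_cmd : cmd G; fc_counter : term G }.

Inductive is_forcing (G : ctx) : ncmd G -> fcmd G -> Prop :=
| forcing_neg (t : pterm G) (u : val G Neg) (K : term G) :
    is_forcing (NCmd (TNeg u) (pair (TPos t) K)) (FCmd (Cut t u) K)
| forcing_pos (t : pterm G) (u : val G Neg) (K : term G) :
    is_forcing (NCmd (TPos t) (pair (TNeg u) K)) (FCmd (Cut t u) K).

(** Divergence on a beta-redex with counter 0 is rendered by a loop. *)
Inductive cd_step (G : ctx) : fcmd G -> fcmd G -> Prop :=
| cd_mu_neg (c : cmd (Neg :: G)) (u : val G Neg) (n : nat) :
    cd_step (FCmd (Cut (MuNeg c) u) (numeral G n)) (FCmd (inst1 c u) (numeral G n))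
| cd_mu_pos (v : val G Pos) (c : cmd (Pos :: G)) (n : nat) :
    cd_step (FCmd (Cut (PVal v) (MuPos c)) (numeral G n)) (FCmd (inst1 c v) (numeral G n))
| cd_pair (e1 e2 : pol) (v1 : val G e1) (v2 : val G e2) (c : cmd (e2 :: e1 :: G)) (n : nat) :
    cd_step (FCmd (Cut (PVal (Pair v1 v2)) (MuPair c)) (numeral G (S n)))
            (FCmd (inst2 c v1 v2) (numeral G n))
| cd_box (e : pol) (v : val G e) (c : cmd (e :: G)) (n : nat) :
    cd_step (FCmd (Cut (PVal (Box v)) (MuBox c)) (numeral G (S n)))
            (FCmd (inst1 c v) (numeral G n))
| cd_pair_div (e1 e2 : pol) (v1 : val G e1) (v2 : val G e2) (c : cmd (e2 :: e1 :: G)) :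
    cd_step (FCmd (Cut (PVal (Pair v1 v2)) (MuPair c)) (numeral G 0))
            (FCmd (Cut (PVal (Pair v1 v2)) (MuPair c)) (numeral G 0))
| cd_box_div (e : pol) (v : val G e) (c : cmd (e :: G)) :
    cd_step (FCmd (Cut (PVal (Box v)) (MuBox c)) (numeral G 0))
            (FCmd (Cut (PVal (Box v)) (MuBox c)) (numeral G 0)).

Definition cd_normalizes (G : ctx) (f : fcmd G) : Prop :=
  exists f', clos_refl_trans _ (@cd_step G) f f' /\ (forall f'', ~ cd_step f' f'').

Definition k_bullet (d : ncmd []) : Prop :=
  exists f, is_forcing d f /\ cd_normalizes f.

Inductive mal : Type :=
| MVar : nat -> mal
| MNVar : nat -> mal
| MTensor : mal -> mal -> mal
| MPar : mal -> mal -> mal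
| MDown : mal -> mal
| MUp : mal -> mal.

Definition mal_pol (A : mal) : pol :=
  match A with
  | MVar _ | MTensor _ _ | MDown _ => Pos
  | MNVar _ | MPar _ _ | MUp _ => Neg
  end.

Fixpoint mal_dual (A : mal) : mal :=
  match A with
  | MVar X => MNVar X
  | MNVar X => MVar X
  | MTensor A B => MPar (mal_dual A) (mal_dual B)
  | MPar A B => MTensor (mal_dual A) (mal_dual B)
  | MDown A => MUp (mal_dual A)
  | MUp A => MDown (mal_dual A)
  end.

Definition wset : Type := cterm -> nat -> Prop.

Definition worthogonal (k : ccmd -> nat -> Prop) (t : cterm) (p : nat) (u : cterm) (q : nat) : Prop :=
  match t, u with
  | TPos a, TNeg b | TNeg b, TPos a => k (Cut a b) (p + q)
  | _, _ => False
  end.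

(** The orthogonal of a set X of weighted terms of polarity e. *)
Definition worth (k : ccmd -> nat -> Prop) (e : pol) (X : wset) : wset :=
  fun t p => tpol t = opp e /\ forall u q, X u q -> worthogonal k t p u q.

Definition wtensor (X Y : wset) : wset :=
  fun t n => exists t1 t2 p q,
    X t1 p /\ Y t2 q /\ t = TPos (pair t1 t2) /\ n = p + q.

Definition wdown (X : wset) : wset :=
  fun t n => exists t1, X t1 n /\ t = TPos (box t1).

(** [winterp] is ||A|| and [winterp_dual] is ||A^perp||. *)
Fixpoint winterp (k : ccmd -> nat -> Prop) (rho : nat -> wset) (A : mal) : wset :=
  match A with
  | MVar X => rho X
  | MNVar X => worth k Pos (rho X)
  | MTensor A B => wtensor (winterp k rho A) (winterp k rho B)
  | MPar A B => worth k Pos (wtensor (winterp_dual k rho A) (winterp_dual k rho B))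
  | MDown A => wdown (winterp k rho A)
  | MUp A => worth k Pos (wdown (winterp_dual k rho A))
  end
with winterp_dual (k : ccmd -> nat -> Prop) (rho : nat -> wset) (A : mal) : wset :=
  match A with
  | MVar X => worth k Pos (rho X)
  | MNVar X => rho X
  | MTensor A B => worth k Pos (wtensor (winterp k rho A) (winterp k rho B))
  | MPar A B => wtensor (winterp_dual k rho A) (winterp_dual k rho B)
  | MDown A => worth k Pos (wdown (winterp k rho A))
  | MUp A => wdown (winterp_dual k rho A)
  end.

Lemma winterp_dualE k rho A :
  winterp k rho (mal_dual A) = winterp_dual k rho A /\
  winterp_dual k rho (mal_dual A) = winterp k rho A.
Proof.
  induction A as [X|X|A [IA1 IA2] B [IB1 IB2]|A [IA1 IA2] B [IB1 IB2]|A [IA1 IA2]|A [IA1 IA2]];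
    simpl; rewrite ?IA1, ?IA2, ?IB1, ?IB2; split; reflexivity.
Qed.

(** For positive P, ||P|| is in general not closed under biorthogonality (it omits
    mu a.<V|a> for V in ||P||): the realizers of P are the elements of the
    biorthogonal of ||P||.  For negative N, ||N|| is already an orthogonal. *)
Definition realizes_time (k : ccmd -> nat -> Prop) (rho : nat -> wset)
    (t : cterm) (n : nat) (A : mal) : Prop :=
  match mal_pol A with
  | Pos => worth k Neg (worth k Pos (winterp k rho A)) t n
  | Neg => winterp k rho A t n
  end.

Definition rho_time (X : nat) : wset := fun t _ => t = TPos (PVal (Daimon Pos)).

(** Closed numerical expressions are identified with the number they denote, so
    that quantifiers are higher-order; [FEx] applies to positive formulas and
    [FAll] to negative ones. *)
Inductive form : Type :=
| FVar : nat -> nat -> form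
| FNVar : nat -> nat -> form
| FConst : nat -> form
| FNConst : nat -> form
| FTensor : form -> form -> form
| FPar : form -> form -> form
| FDown : form -> form
| FUp : form -> form
| FEx : (nat -> form) -> form
| FAll : (nat -> form) -> form
| FEq : nat -> nat -> form -> form.

Fixpoint form_pol (A : form) : pol :=
  match A with
  | FVar _ _ | FConst _ | FTensor _ _ | FDown _ | FEx _ => Pos
  | FNVar _ _ | FNConst _ | FPar _ _ | FUp _ | FAll _ => Neg
  | FEq _ _ A => form_pol A
  end.

Fixpoint form_dual (A : form) : form :=
  match A with
  | FVar X p => FNVar X p
  | FNVar X p => FVar X p
  | FConst p => FNConst p
  | FNConst p => FConst p
  | FTensor A B => FPar (form_dual A) (form_dual B)
  | FPar A B => FTensor (form_dual A) (form_dual B)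
  | FDown A => FUp (form_dual A)
  | FUp A => FDown (form_dual A)
  | FEx A => FAll (fun r => form_dual (A r))
  | FAll A => FEx (fun r => form_dual (A r))
  | FEq p q A => FEq p q (form_dual A)
  end.

Definition lolli (A B : form) : form := FPar (form_dual A) B.

Definition tset : Type := cterm -> Prop.

(** ||N|| from ||N^perp||, with terms of both polarities. *)
Definition orth (k : ncmd [] -> Prop) (X : tset) : tset :=
  fun t => forall u, X (TPos u) -> k (NCmd t u).

Definition tensor (X Y : tset) : tset :=
  fun t => exists t1 t2, X t1 /\ Y t2 /\ t = TPos (pair t1 t2).

Definition down (X : tset) : tset :=
  fun t => exists t1, X t1 /\ t = TPos (box t1).

Definition const_interp (p : nat) : tset := fun t => exists n, p <= n /\ t = numeral [] n.

(** For negative A, a false equation gives the set of all negative closed terms,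
    the orthogonal of the empty set; for positive A, dually, it gives the empty
    set, so that an equation under an existential quantifier restricts its range. *)
Definition eq_interp (p q : nat) (e : pol) (X : tset) : tset :=
  fun t => (p = q /\ X t) \/ (p <> q /\ e = Neg /\ tpol t = Neg).

(** [interp] is ||A|| and [interp_dual] is ||A^perp||. *)
Fixpoint interp (k : ncmd [] -> Prop) (rho : nat -> nat -> tset) (A : form) : tset :=
  match A with
  | FVar X p => rho X p
  | FNVar X p => orth k (rho X p)
  | FConst p => const_interp p
  | FNConst p => orth k (const_interp p)
  | FTensor A B => tensor (interp k rho A) (interp k rho B)
  | FPar A B => orth k (tensor (interp_dual k rho A) (interp_dual k rho B))
  | FDown A => down (interp k rho A)
  | FUp A => orth k (down (interp_dual k rho A))
  | FEx A => fun t => exists r, interp k rho (A r) t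
  | FAll A => orth k (fun t => exists r, interp_dual k rho (A r) t)
  | FEq p q A => eq_interp p q (form_pol A) (interp k rho A)
  end
with interp_dual (k : ncmd [] -> Prop) (rho : nat -> nat -> tset) (A : form) : tset :=
  match A with
  | FVar X p => orth k (rho X p)
  | FNVar X p => rho X p
  | FConst p => orth k (const_interp p)
  | FNConst p => const_interp p
  | FTensor A B => orth k (tensor (interp k rho A) (interp k rho B))
  | FPar A B => tensor (interp_dual k rho A) (interp_dual k rho B)
  | FDown A => orth k (down (interp k rho A))
  | FUp A => down (interp_dual k rho A)
  | FEx A => orth k (fun t => exists r, interp k rho (A r) t)
  | FAll A => fun t => exists r, interp_dual k rho (A r) t
  | FEq p q A => eq_interp p q (opp (form_pol A)) (interp_dual k rho A)
  end.

Lemma form_pol_dual A : form_pol (form_dual A) = opp (form_pol A).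
Proof. induction A; simpl; auto. Qed.

Lemma orth_ext k (X Y : tset) :
  (forall t, X t <-> Y t) -> forall t, orth k X t <-> orth k Y t.
Proof. intros H t; split; intros T u Hu; apply T, H, Hu. Qed.

Lemma tensor_ext (X Y X' Y' : tset) :
  (forall t, X t <-> X' t) -> (forall t, Y t <-> Y' t) ->
  forall t, tensor X Y t <-> tensor X' Y' t.
Proof.
  intros H H' t; split; intros (a & b & Ha & Hb & E); exists a, b;
    (split; [apply H; auto | split; [apply H'; auto | auto]]).
Qed.

Lemma down_ext (X Y : tset) :
  (forall t, X t <-> Y t) -> forall t, down X t <-> down Y t.
Proof. intros H t; split; intros (a & Ha & E); exists a; (split; [apply H; auto | auto]). Qed.

Lemma interp_dualE k rho A : forall t,
  (interp k rho (form_dual A) t <-> interp_dual k rho A t) /\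
  (interp_dual k rho (form_dual A) t <-> interp k rho A t).
Proof.
  induction A as [X p|X p|p|p|A IA B IB|A IA B IB|A IA|A IA|f IF|f IF|p q A IA];
    intros t; cbn [interp interp_dual form_dual].
  all: try tauto.
  - split; [apply orth_ext|]; apply tensor_ext; intros; first [apply IA | apply IB].
  - split; [|apply orth_ext]; apply tensor_ext; intros; first [apply IA | apply IB].
  - split; [apply orth_ext|]; apply down_ext; intros; apply IA.
  - split; [|apply orth_ext]; apply down_ext; intros; apply IA.
  - split; [apply orth_ext; intros u|]; split; intros [r H]; exists r; apply IF; auto.
  - split; [|apply orth_ext; intros u]; split; intros [r H]; exists r; apply IF; auto.
  - rewrite form_pol_dual; unfold eq_interp.
    replace (opp (opp (form_pol A))) with (form_pol A) by (destruct (form_pol A); auto).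
    specialize (IA t); tauto.
Qed.

Definition realizes_bullet (k : ncmd [] -> Prop) (rho : nat -> nat -> tset)
    (t : cterm) (A : form) : Prop := interp k rho A t.

Definition rho_bullet (X p : nat) : tset := fun t => t = TPos (PVal (Daimon Pos)).

Definition fbar (Z : nat -> form) : nat -> form :=
  fun r => FAll (fun r' => lolli (Z r') (FNConst (r + r'))).

(** The tensor of two predicates for the forcing structure. *)
Definition ftensor (Y Z : nat -> form) : nat -> form :=
  fun r => FEx (fun p1 => FEx (fun p2 => FEq r (p1 + p2) (FTensor (Y p1) (Z p2)))).

Definition fdown (Z : nat -> form) : nat -> form := fun r => FDown (Z r).

(** [star] is A^* and [star_dual] is (A^perp)^*. *)
Fixpoint star (A : mal) : nat -> form :=
  match A with
  | MVar X => FVar X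
  | MNVar X => fbar (FVar X)
  | MTensor A B => ftensor (star A) (star B)
  | MPar A B => fbar (ftensor (star_dual A) (star_dual B))
  | MDown A => fdown (star A)
  | MUp A => fbar (fdown (star_dual A))
  end
with star_dual (A : mal) : nat -> form :=
  match A with
  | MVar X => fbar (FVar X)
  | MNVar X => FVar X
  | MTensor A B => fbar (ftensor (star A) (star B))
  | MPar A B => ftensor (star_dual A) (star_dual B)
  | MDown A => fbar (fdown (star A))
  | MUp A => fdown (star_dual A)
  end.

Lemma star_dualE A : star (mal_dual A) = star_dual A /\ star_dual (mal_dual A) = star A.
Proof.
  induction A as [X|X|A [IA1 IA2] B [IB1 IB2]|A [IA1 IA2] B [IB1 IB2]|A [IA1 IA2]|A [IA1 IA2]];
    simpl; rewrite ?IA1, ?IA2, ?IB1, ?IB2; split; reflexivity.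
Qed.

Definition forces (p : nat) (A : mal) : form :=
  match mal_pol A with
  | Pos => fbar (fbar (star A)) p
  | Neg => star A p
  end.

(* Main.v *)
(** With a numeral as counter, the countdown machine on [c{n}] runs [c] and
    loops exactly when an (n+1)-st beta-step would be performed, so [c{n}]
    belongs to the countdown pole iff [(c, n)] belongs to the time pole.  As
    [||C[p + r]||] consists of the numerals of the [m >= p + r] and the time pole
    is upward closed in the weight, the forcing orthogonal is then the weighted
    orthogonal of positive formulas, and the two interpretations agree by
    induction on the formula.  The countdown orthogonals also range over terms of
    the wrong polarity; these are excluded because all interpretations are
    inhabited, and a forcing command decomposes unambiguously because they only contain
    values. *)
From Stdlib Require Import List Lia Relations.
Require Import Defs.

Set Implicit Arguments.
Unset Strict Implicit.
Import ListNotations.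

Definition tval (G : ctx) (e : pol) : val G e -> term G :=
  match e with Pos => fun v => TPos (PVal v) | Neg => fun v => TNeg v end.

Lemma pair_tval (G : ctx) (e1 e2 : pol) (v1 : val G e1) (v2 : val G e2) :
  pair (tval v1) (tval v2) = PVal (Pair v1 v2).
Proof. destruct e1, e2; reflexivity. Qed.

Lemma box_tval (G : ctx) (e : pol) (v : val G e) : box (tval v) = PVal (Box v).
Proof. destruct e; reflexivity. Qed.

(** Returning [term], which carries no polarity index, lets [f_equal] recover the components without
    dependent inversion on [Pair]. *)
Definition unpair (G : ctx) (t : pterm G) : option (term G * term G) :=
  match t with
  | PVal v => match v with
              | Pair v1 v2 => Some (tval v1, tval v2)
              | _ => None
              end
  | MuNeg _ => None
  end.

Lemma pair_eq_pair_tval (G : ctx) (t u : term G) (e1 e2 : pol)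
    (v1 : val G e1) (v2 : val G e2) :
  pair t u = pair (tval v1) (tval v2) -> t = tval v1 /\ u = tval v2.
Proof.
  rewrite pair_tval; intros E; apply (f_equal (@unpair G)) in E.
  destruct t as [[v|c]|v], u as [[w|d]|w]; simpl in E; try discriminate;
    injection E as <- <-; split; reflexivity.
Qed.

Lemma k_time_mono (c : ccmd) (n m : nat) : n <= m -> k_time c n -> k_time c m.
Proof. intros Hnm (k & c' & Hk & H); exists k, c'; split; [lia | exact H]. Qed.

Lemma cd_normalizes_k_time (c : ccmd) (n : nat) :
  cd_normalizes (FCmd c (numeral _ n)) <-> k_time c n.
Proof.
  split.
  - intros (f' & Hs & Hf'); apply clos_rt_rt1n in Hs.
    remember (FCmd c (numeral _ n)) as f eqn:Ef; revert c n Ef.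
    induction Hs as [f|f g h Hfg _ IH]; intros c n ->.
    + exists 0, c; repeat split; [lia | constructor |].
      (* A beta-redex is never final for the machine: it loops when the counter is 0, hence the case
         split on [n]. *)
      intros c'' [H|H]; destruct H as [|]; [| |destruct n|destruct n];
        eapply Hf'; constructor.
    + specialize (IH Hf').
      inversion Hfg; subst;
        (destruct (IH _ _ eq_refl) as (k & c' & Hk & Hs' & Hc')).
      1, 2: exists k, c'; repeat split; auto; eapply steps0_mu; eauto; constructor.
      1, 2: exists (S k), c'; repeat split; [lia | | auto];
        eapply steps0_beta; eauto; constructor.
      (* The looping steps return to the same state, so the induction hypothesis already
         concludes. *)
      all: exists k, c'; auto.
  - intros (k & c' & Hk & Hs & Hc').
    revert n Hk; induction Hs as [c|k c d c' Hcd _ IH|k c d c' Hcd _ IH]; intros n Hk.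
    + exists (FCmd c (numeral _ n)); split; [apply rt_refl|].
      intros f'' H; inversion H; subst; eapply Hc';
        solve [left; constructor | right; constructor].
    + destruct (IH Hc' n Hk) as (f & Hf & Hn); exists f; split; [|exact Hn].
      eapply rt_trans; [apply rt_step|exact Hf]; destruct Hcd; constructor.
    (* The bound [S k <= n] leaves a positive counter to pay for this beta-step. *)
    + destruct n as [|n]; [lia|].
      destruct (IH Hc' n ltac:(lia)) as (f & Hf & Hn); exists f; split; [|exact Hn].
      eapply rt_trans; [apply rt_step|exact Hf]; destruct Hcd; constructor.
Qed.

Lemma k_bullet_worthogonal (t : cterm) (e : pol) (v : val [] e) (p q : nat) :
  k_bullet (NCmd t (pair (tval v) (numeral _ (p + q)))) <->
  worthogonal k_time t p (tval v) q.
Proof.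
  (* The counter is a value too, so the whole pair can be decomposed. *)
  change (numeral [] (p + q)) with (tval (Num (G:=[]) (p + q))).
  split.
  - intros (f & Hf & Hn).
    inversion Hf as [a b K Et Ef|a b K Et Ef]; subst t f;
      match goal with H : pair _ _ = _ |- _ =>
        apply (pair_eq_pair_tval (v2 := Num (p + q))) in H as [<- ->] end;
      apply cd_normalizes_k_time; exact Hn.
  - intros H.
    destruct t as [a|b], e; simpl in H; try contradiction;
      eexists; (split; [|apply cd_normalizes_k_time; exact H]); constructor.
Qed.

Lemma interp_fbar (k : ncmd [] -> Prop) rho (Z : nat -> form) (p : nat) (t : cterm) :
  interp k rho (fbar Z p) t <->
  forall r u m, interp k rho (Z r) u -> p + r <= m ->
    k (NCmd t (pair u (numeral _ m))).
Proof.
  split.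
  - intros H r u m Hu Hm; apply H; exists r, u, (numeral _ m).
    split; [apply interp_dualE; exact Hu|].
    split; [exists m; auto | reflexivity].
  - intros H a (r & u & K & Hu & (m & Hm & ->) & [= ->]).
    apply (H r); [apply interp_dualE; exact Hu | exact Hm].
Qed.

(** The induction invariant: the last two fields are what the passage to orthogonals consumes. *)
Record agree (e : pol) (W : wset) (Z : nat -> form) : Prop := Agree {
  agree_iff : forall t p, W t p <-> interp k_bullet rho_bullet (Z p) t;
  agree_inhabited : exists t p, W t p;
  agree_val : forall t p, W t p -> exists v : val [] e, t = tval v }.

Lemma worth_fbar (e : pol) (W : wset) (Z : nat -> form) :
  agree e W Z ->
  forall t p, worth k_time e W t p <-> interp k_bullet rho_bullet (fbar Z p) t.
Proof.
  intros [Hiff (u0 & q0 & Hu0) Hval] t p; rewrite interp_fbar; split.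
  - intros [_ H] r u m Hu Hm; apply Hiff in Hu.
    destruct (Hval _ _ Hu) as [v ->].
    (* A larger counter [m] is read as [u] carrying weight [m - p], at least [r]; monotonicity of
       the pole absorbs the excess. *)
    replace m with (p + (m - p)) by lia.
    apply k_bullet_worthogonal; specialize (H _ _ Hu).
    destruct t, (tval v); simpl in *; try contradiction;
      revert H; apply k_time_mono; lia.
  - intros H.
    assert (Horth : forall u q, W u q -> worthogonal k_time t p u q).
    { intros u q Hu; destruct (Hval _ _ Hu) as [v ->].
      apply k_bullet_worthogonal, (H q); [apply Hiff; exact Hu | lia]. }
    split; [|exact Horth].
    (* Testing against one inhabitant of [W] forces the polarity of [t]. *)
    destruct (Hval _ _ Hu0) as [v ->]; specialize (Horth _ _ Hu0).
    destruct t, e; simpl in *; try contradiction; reflexivity.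
Qed.

Lemma agree_worth (W : wset) (Z : nat -> form) :
  agree Pos W Z -> agree Neg (worth k_time Pos W) (fbar Z).
Proof.
  intros HW; split.
  - exact (worth_fbar HW).
  (* A positive value cut against the negative daimon is already normal, so weight 0 suffices. *)
  - exists (TNeg (Daimon Neg)), 0; split; [reflexivity|].
    intros u q Hu; destruct (agree_val HW Hu) as [v ->].
    exists 0; eexists; repeat split; [lia | constructor |].
    intros c'' [H|H]; inversion H.
  - intros [a|b] p [Hpol _]; [discriminate | exists b; reflexivity].
Qed.

Lemma agree_var (X : nat) : agree Pos (rho_time X) (FVar X).
Proof.
  split.
  - reflexivity.
  - exists (TPos (PVal (Daimon Pos))), 0; reflexivity.
  - intros t p ->; exists (Daimon Pos); reflexivity.
Qed.

Lemma agree_tensor (e1 e2 : pol) (W1 W2 : wset) (Z1 Z2 : nat -> form) :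
  agree e1 W1 Z1 -> agree e2 W2 Z2 -> agree Pos (wtensor W1 W2) (ftensor Z1 Z2).
Proof.
  intros [I1 (u1 & q1 & N1) V1] [I2 (u2 & q2 & N2) V2]; split.
  - intros t p; split.
    + intros (t1 & t2 & p1 & p2 & H1 & H2 & -> & ->).
      exists p1, p2; left; split; [reflexivity|].
      exists t1, t2; split; [apply I1, H1 | split; [apply I2, H2 | reflexivity]].
    (* A false equation on a positive formula contributes no element, so the existentials range
       exactly over the splittings of [p]. *)
    + intros (p1 & p2 & [[-> (t1 & t2 & H1 & H2 & ->)]|(_ & He & _)]);
        [|discriminate].
      exists t1, t2, p1, p2; apply I1 in H1; apply I2 in H2; auto.
  - exists (TPos (pair u1 u2)), (q1 + q2), u1, u2, q1, q2; auto.
  - intros t p (t1 & t2 & p1 & p2 & H1 & H2 & -> & _).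
    destruct (V1 _ _ H1) as [v1 ->], (V2 _ _ H2) as [v2 ->].
    exists (Pair v1 v2); rewrite pair_tval; reflexivity.
Qed.

Lemma agree_down (e : pol) (W : wset) (Z : nat -> form) :
  agree e W Z -> agree Pos (wdown W) (fdown Z).
Proof.
  intros [I (u & q & N) V]; split.
  - intros t p; split; intros (t1 & H & ->); exists t1; apply I in H; auto.
  - exists (TPos (box u)), q, u; auto.
  - intros t p (t1 & H & ->); destruct (V _ _ H) as [v ->].
    exists (Box v); rewrite box_tval; reflexivity.
Qed.

Lemma agree_winterp (A : mal) :
  agree (mal_pol A) (winterp k_time rho_time A) (star A) /\
  agree (opp (mal_pol A)) (winterp_dual k_time rho_time A) (star_dual A).
Proof.
  induction A as [X|X|A [IA IA'] B [IB IB']|A [IA IA'] B [IB IB']|A [IA IA']|A [IA IA']];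
    simpl; split;
    eauto using agree_worth, agree_var, agree_tensor, agree_down.
Qed.

Theorem theorem94 (A : mal) (t : cterm) (n : nat) :
  realizes_time k_time rho_time t n A <->
  realizes_bullet k_bullet rho_bullet t (forces n A).
Proof.
  destruct (agree_winterp A) as [HA _].
  unfold realizes_time, realizes_bullet, forces.
  (* A biorthogonal may contain non-values, so [agree] stops at the first orthogonal; the second one
     only needs the equivalence [worth_fbar]. *)
  destruct (mal_pol A); [exact (worth_fbar (agree_worth HA) t n) | exact (agree_iff HA t n)].
Qed.
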